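(* Let $(\mathfrak g,[\cdot,\cdot,\cdot]_{\mathfrak g})$ be a finite-dimensional $3$-Lie algebra over $\mathbb R$ or $\mathbb C$. Then $\mathfrak g$ has a strong abelian product structure if and only if $\mathfrak g$ admits a decomposition $\mathfrak g=\mathfrak g_+\oplus\mathfrak g_-$ (direct sum of vector spaces), where $\mathfrak g_+$ and $\mathfrak g_-$ are nonzero abelian subalgebras of $\mathfrak g$ such that $[\mathfrak g_+,\mathfrak g_+,\mathfrak g_-]_{\mathfrak g}\subset\mathfrak g_+$ and $[\mathfrak g_-,\mathfrak g_-,\mathfrak g_+]_{\mathfrak g}\subset\mathfrak g_-$.
   Context: A $3$-Lie algebra is a vector space $\mathfrak g$ with a trilinear skew-symmetric bracket $[\cdot,\cdot,\cdot]_{\mathfrak g}$ satisfying $[x,y,[z,w,v]]=[[x,y,z],w,v]+[z,[x,y,w],v]+[z,w,[x,y,v]]$. A subalgebra $\mathfrak a$ is abelian if $[\mathfrak a,\mathfrak a,\mathfrak a]_{\mathfrak g}=0$. An almost product structure on $\mathfrak g$ is a linear map $E:\mathfrak g\to\mathfrak g$ with $E^2=\mathrm{Id}$ and $E\neq\pm\mathrm{Id}$. It is called a strong abelian product structure if $[x,y,z]_{\mathfrak g}=E[Ex,y,z]_{\mathfrak g}+E[x,Ey,z]_{\mathfrak g}+E[x,y,Ez]_{\mathfrak g}$ for all $x,y,z\in\mathfrak g$. *)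

(* Defs.v *)
From mathcomp Require Import all_boot all_order all_algebra.
From mathcomp Require Import reals.
From mathcomp Require Import complex.

Set Implicit Arguments.
Unset Strict Implicit.
Unset Printing Implicit Defensive.

Import GRing.Theory.
Local Open Scope ring_scope.

Record threeLie (K : fieldType) (g : lmodType K) := ThreeLie {
  bracket :> g -> g -> g -> g;
  bracket_linear1 : forall y z, linear (fun x => bracket x y z);
  bracket_linear2 : forall x z, linear (fun y => bracket x y z);
  bracket_linear3 : forall x y, linear (fun z => bracket x y z);
  (* These two transpositions generate the symmetric group on the arguments. *)
  bracket_skew12 : forall x y z, bracket y x z = - bracket x y z;
  bracket_skew23 : forall x y z, bracket x z y = - bracket x y z;
  bracket_fundamental : forall x y z w v,
    bracket x y (bracket z w v) =
      bracket (bracket x y z) w v + bracket z (bracket x y w) v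
      + bracket z w (bracket x y v)
}.

Section Structures.
Variables (K : fieldType) (g : vectType K) (br : threeLie g).

Definition subalgebra (a : {vspace g}) : Prop :=
  forall x y z, x \in a -> y \in a -> z \in a -> br x y z \in a.

Definition abelian_subalgebra (a : {vspace g}) : Prop :=
  subalgebra a /\
  forall x y z, x \in a -> y \in a -> z \in a -> br x y z = 0.

(* [a, b, c] is contained in d; since d is a subspace it does not matter
   whether [a, b, c] means the set of brackets or its linear span. *)
Definition bracket_sub (a b c d : {vspace g}) : Prop :=
  forall x y z, x \in a -> y \in b -> z \in c -> br x y z \in d.

Definition almost_product_structure (E : 'End(g)) : Prop :=
  [/\ (E \o E)%VF = \1%VF, E <> \1%VF & E <> - \1%VF].

Definition strong_abelian_product_structure (E : 'End(g)) : Prop :=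
  almost_product_structure E /\
  forall x y z,
    br x y z = E (br (E x) y z) + E (br x (E y) z) + E (br x y (E z)).

Definition direct_sum_decomposition (a b : {vspace g}) : Prop :=
  (a + b = fullv)%VS /\ directv (a + b).

End Structures.

(* Main.v *)
Require Import Defs.
From mathcomp Require Import all_boot all_order all_algebra.
From mathcomp Require Import reals.
From mathcomp Require Import complex.

From mathcomp Require Import ring.

Set Implicit Arguments.
Unset Strict Implicit.
Unset Printing Implicit Defensive.

Import GRing.Theory.
Local Open Scope ring_scope.

(** Over a field with 2 != 0, an involution E splits g into its eigenspaces for
    the eigenvalues 1 and -1, which are the fixed spaces of E and of - E.  On
    eigenvectors of eigenvalues a, b, c the strong abelian identity collapses
    (strong_eigenP) to the single equation
      [x, y, z] = (a + b + c) E [x, y, z].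
    When all three signs agree the factor is 3 or -3, so applying E once more
    gives 9 w = w, hence 8 w = 0 and w = 0: each eigenspace is abelian.  When
    the signs are mixed, a + b + c is 1 or -1, the sign of the majority, and the
    equation says exactly that the bracket lies in the eigenspace of that sign.

    Both sides of the identity being trilinear, it holds everywhere as soon as
    it holds on eigenvectors; so the same computation, read backwards for the
    reflection attached to a decomposition, gives the converse
    (strong_of_decomposition).  The identity is quadratic in E, so - E satisfies
    it too, and all statements about the minus space are those about the plus
    space of - E. *)

Section StrongAbelian.
Variables (K : fieldType) (g : vectType K) (br : threeLie g).
Implicit Types (E : 'End(g)) (U V : {vspace g}) (x y z : g) (a b c : K).

(** * Trilinearity *)

Lemma bracketDl x x' y z : br (x + x') y z = br x y z + br x' y z.
Proof. by have := bracket_linear1 br y z 1 x x'; rewrite !scale1r. Qed.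

Lemma bracketDm x y y' z : br x (y + y') z = br x y z + br x y' z.
Proof. by have := bracket_linear2 br x z 1 y y'; rewrite !scale1r. Qed.

Lemma bracketDr x y z z' : br x y (z + z') = br x y z + br x y z'.
Proof. by have := bracket_linear3 br x y 1 z z'; rewrite !scale1r. Qed.

Lemma bracket0l y z : br 0 y z = 0.
Proof. by apply: (@addrI _ (br 0 y z)); rewrite -bracketDl !addr0. Qed.

Lemma bracketZl a x y z : br (a *: x) y z = a *: br x y z.
Proof. by have := bracket_linear1 br y z a x 0; rewrite bracket0l !addr0. Qed.

Lemma bracketZm a x y z : br x (a *: y) z = a *: br x y z.
Proof. by rewrite bracket_skew12 bracketZl bracket_skew12 scalerN opprK. Qed.

Lemma bracketZr a x y z : br x y (a *: z) = a *: br x y z.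
Proof. by rewrite bracket_skew23 bracketZm bracket_skew23 scalerN opprK. Qed.

Lemma bracket_rot x y z : br x y z = br y z x.
Proof. by rewrite (bracket_skew23 br y x) (bracket_skew12 br x y) opprK. Qed.

(** * The strong abelian identity on eigenvectors *)

Definition strong_identity E x y z : Prop :=
  br x y z = E (br (E x) y z) + E (br x (E y) z) + E (br x y (E z)).

(** The common core of both directions: everything about the identity is read
    off from the sign sum a + b + c. *)
Lemma strong_eigenP E a b c x y z :
  E x = a *: x -> E y = b *: y -> E z = c *: z ->
  strong_identity E x y z <-> br x y z = (a + b + c) *: E (br x y z).
Proof.
move=> Ex Ey Ez; rewrite /strong_identity Ex Ey Ez.
by rewrite bracketZl bracketZm bracketZr !linearZ -!scalerDl.
Qed.

Lemma strong_identityD1 E x x' y z :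
  strong_identity E x y z -> strong_identity E x' y z ->
  strong_identity E (x + x') y z.
Proof.
rewrite /strong_identity => e e'.
by rewrite !(linearD, bracketDl) e e' addrACA [in LHS](addrACA (E _)).
Qed.

Lemma strong_identityD2 E x y y' z :
  strong_identity E x y z -> strong_identity E x y' z ->
  strong_identity E x (y + y') z.
Proof.
rewrite /strong_identity => e e'.
by rewrite !(linearD, bracketDm) e e' addrACA [in LHS](addrACA (E _)).
Qed.

Lemma strong_identityD3 E x y z z' :
  strong_identity E x y z -> strong_identity E x y z' ->
  strong_identity E x y (z + z').
Proof.
rewrite /strong_identity => e e'.
by rewrite !(linearD, bracketDr) e e' addrACA [in LHS](addrACA (E _)).
Qed.

Lemma fixedSpace_eigen E x : x \in fixedSpace E -> E x = 1 *: x.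
Proof. by move/fixedSpaceP->; rewrite scale1r. Qed.

Lemma fixedSpaceN_eigen E x : x \in fixedSpace (- E) -> E x = -1 *: x.
Proof. by move/fixedSpaceP => {2}<-; rewrite opp_lfunE scaleN1r opprK. Qed.

(** * From a structure to its eigenspaces *)

Lemma strong_abelianN E : strong_abelian_product_structure br E ->
  strong_abelian_product_structure br (- E).
Proof.
case=> -[EE E1 EN1] idE; split.
  split; first by rewrite comp_lfunNl comp_lfunNr opprK.
    by move=> e; apply: EN1; rewrite -e opprK.
  by move/oppr_inj.
move=> x y z; rewrite !opp_lfunE -(scaleN1r (E x)) -(scaleN1r (E y)).
rewrite -(scaleN1r (E z)) bracketZl bracketZm bracketZr !linearZ /=.
by rewrite !scaleN1r !opprK; apply: idE.
Qed.

Lemma involutionK E : (E \o E)%VF = \1%VF -> involutive E.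
Proof. by move=> EE x; rewrite -comp_lfunE EE id_lfunE. Qed.

(** Since x + E x is always fixed, an involution with no nonzero fixed vector
    sends every x to - x. *)
Lemma fixedSpace_neq0 E : almost_product_structure E -> fixedSpace E <> 0%VS.
Proof.
case=> EE _ EN1 fix0; apply: EN1; apply/lfunP => x.
rewrite opp_lfunE id_lfunE; apply/eqP; rewrite -addr_eq0 -memv0 -fix0.
by apply/fixedSpaceP; rewrite linearD /= involutionK // addrC.
Qed.

Section CharNot2.
Hypothesis two_neq0 : 2%:R != 0 :> K.

Lemma fixedSpace_abelian E : strong_abelian_product_structure br E ->
  abelian_subalgebra br (fixedSpace E).
Proof.
case=> -[EE _ _] idE.
suff br0 x y z : x \in fixedSpace E -> y \in fixedSpace E ->
    z \in fixedSpace E -> br x y z = 0.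
  by split=> // x y z xE yE zE; rewrite br0 ?mem0v.
move=> /fixedSpace_eigen xE /fixedSpace_eigen yE /fixedSpace_eigen zE.
have /(strong_eigenP xE yE zE) := idE x y z.
set w := br x y z => w_eq.
have Ew : E w = (1 + 1 + 1) *: w.
  by rewrite {1}w_eq linearZ /= involutionK.
(* w = (1 + 1 + 1) *: E w, and E w = (1 + 1 + 1) *: w: so 9 w = w. *)
have /eqP : (2%:R ^+ 3) *: w = 0.
  rewrite Ew scalerA in w_eq.
  have -> : 2%:R ^+ 3 = (1 + 1 + 1) * (1 + 1 + 1) - 1 :> K by ring.
  by rewrite scalerBl -w_eq scale1r subrr.
by rewrite scaler_eq0 expf_eq0 (negPf two_neq0) => /eqP.
Qed.

Lemma fixedSpace_bracket E : strong_abelian_product_structure br E ->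
  bracket_sub br (fixedSpace E) (fixedSpace E) (fixedSpace (- E))
    (fixedSpace E).
Proof.
case=> _ idE x y z.
move=> /fixedSpace_eigen xE /fixedSpace_eigen yE /fixedSpaceN_eigen zE.
have /(strong_eigenP xE yE zE) := idE x y z.
by rewrite addrK scale1r => w_eq; apply/fixedSpaceP.
Qed.

(** The components of x are (x + E x) / 2 and (x - E x) / 2; a vector in both
    fixed spaces satisfies x = - x. *)
Lemma fixedSpace_decomposition E : (E \o E)%VF = \1%VF ->
  direct_sum_decomposition (fixedSpace E) (fixedSpace (- E)).
Proof.
move=> EE; have EEx := involutionK EE.
split.
  apply/eqP; rewrite eqEsubv subvf; apply/subvP => x _; apply/memv_addP.
  exists (2%:R^-1 *: (x + E x)).
    by apply: memvZ; apply/fixedSpaceP; rewrite linearD /= EEx addrC.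
  exists (2%:R^-1 *: (x - E x)).
    apply: memvZ; apply/fixedSpaceP.
    by rewrite opp_lfunE linearB /= EEx opprB.
  by rewrite -scalerDr addrACA subrr addr0 -mulr2n -scaler_nat scalerA
    mulVf // scale1r.
apply/directv_addP/eqP; rewrite -subv0; apply/subvP => x; rewrite memv_cap memv0.
case/andP=> /fixedSpaceP xE /fixedSpaceP; rewrite opp_lfunE xE => /eqP.
by rewrite eq_sym -addr_eq0 -mulr2n -scaler_nat scaler_eq0 (negPf two_neq0).
Qed.

Lemma decomposition_of_strong E : strong_abelian_product_structure br E ->
  let gp := fixedSpace E in let gm := fixedSpace (- E) in
  direct_sum_decomposition gp gm /\
  (gp <> 0%VS /\ abelian_subalgebra br gp) /\
  (gm <> 0%VS /\ abelian_subalgebra br gm) /\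
  bracket_sub br gp gp gm gp /\ bracket_sub br gm gm gp gm.
Proof.
move=> sE gp gm; have sNE := strong_abelianN sE.
have [[/fixedSpace_decomposition dec _ _] _] := sE.
split=> //; split; [|split; [|split]].
- by split; [apply: fixedSpace_neq0 sE.1 | apply: fixedSpace_abelian].
- by split; [apply: fixedSpace_neq0 sNE.1 | apply: fixedSpace_abelian].
- exact: fixedSpace_bracket.
- by have := fixedSpace_bracket sNE; rewrite opprK.
Qed.

(** * From a decomposition to its reflection *)

Definition reflection U V : 'End(g) := daddv_pi U V - daddv_pi V U.

Lemma reflection_l U V x : (U :&: V = 0)%VS -> x \in U ->
  reflection U V x = 1 *: x.
Proof.
move=> UV0 xU; have VU0 : (V :&: U = 0)%VS by rewrite capvC.
rewrite scale1r !lfunE /= opp_lfunE.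
have := daddv_pi_add UV0 (subvP (addvSl U V) _ xU).
by rewrite daddv_pi_id // => /(canRL (addKr _)) ->; rewrite addNr subr0.
Qed.

Lemma reflection_r U V x : (U :&: V = 0)%VS -> x \in V ->
  reflection U V x = -1 *: x.
Proof.
move=> UV0 xV; rewrite scaleN1r -[x in RHS]scale1r -(@reflection_l V U) //.
  by rewrite -opp_lfunE opprB.
by rewrite capvC.
Qed.

Lemma reflection_almost_product U V :
  direct_sum_decomposition U V -> U <> 0%VS -> V <> 0%VS ->
  almost_product_structure (reflection U V).
Proof.
case=> UVT /directv_addP UV0 U0 V0.
have eqN w : w = - w -> w = 0 :> g.
  move/eqP; rewrite -addr_eq0 -mulr2n -scaler_nat scaler_eq0.
  by rewrite (negPf two_neq0) => /eqP.
split.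
- apply/lfunP => x; have : x \in (U + V)%VS by rewrite UVT memvf.
  case/memv_addP=> u uU [v vV ->]; rewrite comp_lfunE id_lfunE !linearD /=.
  rewrite !(reflection_l UV0 uU) !(reflection_r UV0 vV) !linearZ /=.
  by rewrite !(reflection_l UV0 uU) !(reflection_r UV0 vV) !scalerA
    mulrNN !mulr1 !scale1r.
- move=> E1; apply: V0; apply/eqP; rewrite -subv0; apply/subvP => v vV.
  have := reflection_r UV0 vV; rewrite E1 id_lfunE scaleN1r => /eqN ->.
  exact: mem0v.
move=> E1; apply: U0; apply/eqP; rewrite -subv0; apply/subvP => u uU.
have := reflection_l UV0 uU; rewrite E1 opp_lfunE id_lfunE scale1r.
by move/esym/eqN->; apply: mem0v.
Qed.

Lemma strong_of_decomposition U V :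
  direct_sum_decomposition U V ->
  U <> 0%VS -> abelian_subalgebra br U ->
  V <> 0%VS -> abelian_subalgebra br V ->
  bracket_sub br U U V U -> bracket_sub br V V U V ->
  strong_abelian_product_structure br (reflection U V).
Proof.
move=> dec U0 [_ Uab] V0 [_ Vab] UUV VVU.
split; first exact: reflection_almost_product.
have [UVT /directv_addP UV0] := dec.
have EU := reflection_l UV0; have EV := reflection_r UV0.
pose E := reflection U V.
have split_ind (P : g -> Prop) : (forall x x', P x -> P x' -> P (x + x')) ->
    (forall x, x \in U \/ x \in V -> P x) -> forall x, P x.
  move=> PD PUV x; have : x \in (U + V)%VS by rewrite UVT memvf.
  by case/memv_addP=> u uU [v vV ->]; apply: PD; apply: PUV; [left | right].
suff hom x y z : x \in U \/ x \in V -> y \in U \/ y \in V ->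
    z \in U \/ z \in V -> strong_identity E x y z.
  move=> x y z; rewrite -/(strong_identity E x y z).
  elim/split_ind: x => [x x'|x xUV]; first exact: strong_identityD1.
  elim/split_ind: y => [y y'|y yUV]; first exact: strong_identityD2.
  elim/split_ind: z => [z z'|z zUV]; first exact: strong_identityD3.
  exact: hom.
have inU w : w \in U -> w = 1 *: E w by move/EU->; rewrite !scale1r.
have inV w : w \in V -> w = -1 *: E w.
  by move/EV->; rewrite scalerA mulrNN mulr1 scale1r.
(* Cyclic invariance of the bracket brings the argument of minority sign to the
   last slot. *)
case=> [xU|xV] [yU|yV] [zU|zV].
- by apply/(strong_eigenP (EU _ xU) (EU _ yU) (EU _ zU));
    rewrite Uab // linear0 scaler0.
- apply/(strong_eigenP (EU _ xU) (EU _ yU) (EV _ zV)).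
  by rewrite addrK; apply/inU/UUV.
- apply/(strong_eigenP (EU _ xU) (EV _ yV) (EU _ zU)).
  by rewrite subrr add0r -bracket_rot; apply/inU/UUV.
- apply/(strong_eigenP (EU _ xU) (EV _ yV) (EV _ zV)).
  by rewrite subrr add0r bracket_rot; apply/inV/VVU.
- apply/(strong_eigenP (EV _ xV) (EU _ yU) (EU _ zU)).
  by rewrite addNr add0r bracket_rot; apply/inU/UUV.
- apply/(strong_eigenP (EV _ xV) (EU _ yU) (EV _ zV)).
  by rewrite addNr add0r -bracket_rot; apply/inV/VVU.
- apply/(strong_eigenP (EV _ xV) (EV _ yV) (EU _ zU)).
  by rewrite addrNK; apply/inV/VVU.
- by apply/(strong_eigenP (EV _ xV) (EV _ yV) (EV _ zV));
    rewrite Vab // linear0 scaler0.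
Qed.

Theorem strong_abelian_iff_decomposition :
  (exists E : 'End(g), strong_abelian_product_structure br E) <->
  (exists gp gm : {vspace g},
    direct_sum_decomposition gp gm /\
    (gp <> 0%VS /\ abelian_subalgebra br gp) /\
    (gm <> 0%VS /\ abelian_subalgebra br gm) /\
    bracket_sub br gp gp gm gp /\
    bracket_sub br gm gm gp gm).
Proof.
split=> [[E sE]|[U [V [dec [[U0 Uab] [[V0 Vab] [UUV VVU]]]]]]].
  by exists (fixedSpace E), (fixedSpace (- E)); apply: decomposition_of_strong.
by exists (reflection U V); apply: strong_of_decomposition.
Qed.

End CharNot2.
End StrongAbelian.

Theorem corollary5p12 (R : realType) :
  (forall (g : vectType R) (br : threeLie g),
    (exists E : 'End(g), strong_abelian_product_structure br E) <->
    (exists gp gm : {vspace g},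
      direct_sum_decomposition gp gm /\
      (gp <> 0%VS /\ abelian_subalgebra br gp) /\
      (gm <> 0%VS /\ abelian_subalgebra br gm) /\
      bracket_sub br gp gp gm gp /\
      bracket_sub br gm gm gp gm))
  /\
  (forall (g : vectType (complex R)) (br : threeLie g),
    (exists E : 'End(g), strong_abelian_product_structure br E) <->
    (exists gp gm : {vspace g},
      direct_sum_decomposition gp gm /\
      (gp <> 0%VS /\ abelian_subalgebra br gp) /\
      (gm <> 0%VS /\ abelian_subalgebra br gm) /\
      bracket_sub br gp gp gm gp /\
      bracket_sub br gm gm gp gm)).
Proof.
by split=> g br; apply: strong_abelian_iff_decomposition;
  rewrite Num.Theory.pnatr_eq0.
Qed.
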